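(* Let $p\ge 1$ and let $A$ be an algebra over $\mathbb{C}$ with multiplication $\mu$, together with linear maps $\partial_{ij}:A\to A\otimes A$ $(1\le i,j\le p)$ such that $(A,\mu,(\partial_{ij})_{1\le i,j\le p})$ is a multivariable GDQ ring. Let $\tilde A=\mathfrak{M}_p\otimes A=\mathfrak{M}_p(A)$ with its multiplication $\tilde\mu$, let $$\Delta_{ij}=\sum_{1\le k\le p}e_{ki}\otimes e_{jk}\in\mathfrak{M}_p\otimes\mathfrak{M}_p ,$$ and define the linear map $\partial:\tilde A\to\tilde A\otimes\tilde A$ by $$\partial(T\otimes a)=\sum_{1\le i,j\le p}\bigl((T\otimes I_p)\Delta_{ij}\bigr)\otimes\partial_{ij}a\in(\mathfrak{M}_p)^{\otimes 2}\otimes A^{\otimes 2}\simeq\tilde A^{\otimes 2}\qquad(T\in\mathfrak{M}_p,\ a\in A),$$ where the isomorphism takes $(T_1\otimes T_2)\otimes(a_1\otimes a_2)$ to $(T_1\otimes a_1)\otimes(T_2\otimes a_2)$. Then $(\tilde A,\tilde\mu,\partial)$ is a GDQ ring, i.e. $\partial$ is a coassociative derivation.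
   Context: A generalized difference quotient ring (GDQ ring) is a triple $(A,\mu,\partial)$ where $A$ is an algebra over $\mathbb{C}$ (not necessarily unital) with multiplication map $\mu:A\otimes A\to A$, and $\partial:A\to A\otimes A$ is a linear map that is coassociative, $(\partial\otimes \mathrm{id}_A)\circ\partial=(\mathrm{id}_A\otimes\partial)\circ\partial$, and a derivation, $\partial\circ\mu=(\mathrm{id}_A\otimes\mu)\circ(\partial\otimes\mathrm{id}_A)+(\mu\otimes\mathrm{id}_A)\circ(\mathrm{id}_A\otimes\partial)$. Here $\otimes$ is the algebraic tensor product over $\mathbb{C}$. A multivariable GDQ ring $(A,\mu,(\partial_s)_{s\in S})$, $S$ a finite index set, is an algebra $(A,\mu)$ with maps $\partial_s$ such that each $(A,\mu,\partial_s)$ is a GDQ ring and the compatibility relations $(\partial_s\otimes\mathrm{id}_A)\circ\partial_t=(\mathrm{id}_A\otimes\partial_t)\circ\partial_s$ hold for all $s,t\in S$. $\mathfrak{M}_p$ denotes the $p\times p$ complex matrices, with matrix units $e_{ij}$ and identity $I_p$. *)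

(* Defs.v *)
From HB Require Import structures.
From mathcomp Require Import all_boot all_order all_algebra.
From mathcomp Require Import boolp reals complex.
From mathcomp Require Import freeg.

Set Implicit Arguments.
Unset Strict Implicit.
Unset Printing Implicit Defensive.

Import GRing.Theory.

Local Open Scope ring_scope.
Local Open Scope quotient_scope.

(* The algebraic tensor product U ⊗ V of two arbitrary (possibly              *)
(* infinite-dimensional) vector spaces: the free vector space on U * V modulo *)
(* the subspace generated by the bilinearity relations.                       *)
Section TensorDef.
Context {K : fieldType} (U V : lmodType K).

Local Notation free := {freeg (U * V)%type / K}.
Local Notation gen u v := (<< (u, v) >> : free).

Inductive tensor_null : free -> Prop :=
| TNullDl u u' v : tensor_null (gen (u + u') v - gen u v - gen u' v)
| TNullDr u v v' : tensor_null (gen u (v + v') - gen u v - gen u v')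
| TNullZl a u v : tensor_null (gen (a *: u) v - a *: gen u v)
| TNullZr a u v : tensor_null (gen u (a *: v) - a *: gen u v)
| TNull0 : tensor_null 0
| TNullP a x y : tensor_null x -> tensor_null y -> tensor_null (a *: x + y).

Definition tensor_nullb : {pred free} := fun x => `[< tensor_null x >].

Lemma tensor_nullZ a x : x \in tensor_nullb -> a *: x \in tensor_nullb.
Proof.
move=> /asboolP xN; apply/asboolP; rewrite -[_ *: _]addr0.
exact: TNullP xN TNull0.
Qed.

Lemma tensor_null_zmod_closed : zmod_closed tensor_nullb.
Proof.
split=> [|x y /asboolP xN /asboolP yN]; first exact/asboolP/TNull0.
by apply/asboolP; rewrite addrC -scaleN1r; apply: TNullP.
Qed.

HB.instance Definition _ :=
  GRing.isZmodClosed.Build free tensor_nullb tensor_null_zmod_closed.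

Definition tquot : Type := Quotient.quot tensor_nullb.

HB.instance Definition _ := GRing.Zmodule.on tquot.
HB.instance Definition _ : EqQuotient free _ tquot :=
  EqQuotient.on tquot.

Definition tquot_pi (x : free) : tquot := \pi_tquot x.

Lemma tquot_piP x y : tquot_pi x = tquot_pi y <-> tensor_null (x - y).
Proof.
rewrite /tquot_pi; split=> [/eqP|xyN]; last first.
  by apply/eqP; rewrite -Quotient.idealrBE; apply/asboolP.
by rewrite -Quotient.idealrBE => /asboolP.
Qed.

Lemma tquot_pi_zmod : zmod_morphism tquot_pi.
Proof. by move=> x y; rewrite /tquot_pi !piE. Qed.

HB.instance Definition _ :=
  GRing.isZmodMorphism.Build free tquot tquot_pi tquot_pi_zmod.

Lemma tquot_reprK (x : tquot) : tquot_pi (repr x) = x.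
Proof. exact: reprK. Qed.

Definition tquot_scale (a : K) (x : tquot) : tquot :=
  tquot_pi (a *: repr x).

Lemma tquot_scale_pi a x : tquot_scale a (tquot_pi x) = tquot_pi (a *: x).
Proof.
apply/tquot_piP; rewrite -scalerBr; apply/asboolP/tensor_nullZ.
by apply/asboolP/tquot_piP; rewrite tquot_reprK.
Qed.

Lemma tquot_scaleA a b x :
  tquot_scale a (tquot_scale b x) = tquot_scale (a * b) x.
Proof. by rewrite -[x]tquot_reprK !tquot_scale_pi scalerA. Qed.

Lemma tquot_scale1 : left_id 1 tquot_scale.
Proof. by move=> x; rewrite -[x]tquot_reprK !tquot_scale_pi scale1r. Qed.

Lemma tquot_scaleDr : right_distributive tquot_scale +%R.
Proof.
move=> a x y; rewrite -[x]tquot_reprK -[y]tquot_reprK -raddfD.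
by rewrite !tquot_scale_pi -raddfD -scalerDr.
Qed.

Lemma tquot_scaleDl x : {morph tquot_scale^~ x : a b / a + b}.
Proof.
by move=> a b; rewrite -[x]tquot_reprK !tquot_scale_pi -raddfD -scalerDl.
Qed.

HB.instance Definition _ := GRing.Zmodule_isLmodule.Build K tquot
  tquot_scaleA tquot_scale1 tquot_scaleDr tquot_scaleDl.

Lemma tquot_pi_scalable : scalable tquot_pi.
Proof. by move=> a x; rewrite -tquot_scale_pi. Qed.

HB.instance Definition _ :=
  GRing.isScalable.Build K free tquot *:%R tquot_pi tquot_pi_scalable.

(* tensor, tensor_pi and tensor_repr are tquot, its projection and its section *)
(* of representatives, sealed by an opaque key to keep unification tractable. *)
Definition tensor_with (k : unit) : lmodType K := let: tt := k in tquot.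

Definition pi_with (k : unit) : {linear free -> tensor_with k} :=
  let: tt := k in tquot_pi.

Definition repr_with (k : unit) : tensor_with k -> free :=
  let: tt := k in (fun x : tquot => repr x).

Fact tensor_key : unit. Proof. exact: tt. Qed.

Definition tensor : lmodType K := tensor_with tensor_key.
Definition tensor_pi : {linear free -> tensor} := pi_with tensor_key.
Definition tensor_repr : tensor -> free := @repr_with tensor_key.

Lemma tensor_piP x y : tensor_pi x = tensor_pi y <-> tensor_null (x - y).
Proof. by rewrite /tensor_pi /tensor; case: tensor_key; apply: tquot_piP. Qed.

Lemma tensor_reprK (x : tensor) : tensor_pi (tensor_repr x) = x.
Proof.
rewrite /tensor_pi /tensor_repr; move: x; rewrite /tensor.
by case: tensor_key => x; apply: tquot_reprK.
Qed.

End TensorDef.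

Arguments tensor_pi {K U V}.

Notation "U ⊗ V" := (tensor U V) (at level 40, left associativity) : type_scope.
Notation "U ⊗ V" := (tensor U V)
  (at level 40, left associativity, only parsing) : ring_scope.

HB.lock Definition tens {K : fieldType} {U V : lmodType K} (u : U) (v : V) :
  U ⊗ V := tensor_pi << (u, v) >>.

Notation "u *t v" := (tens u v) (at level 40, left associativity) : ring_scope.

Lemma tens_is_bilinear (K : fieldType) (U V : lmodType K) :
  bilinear_for *:%R *:%R (@tens K U V).
Proof.
have tDl (u u' : U) (v : V) : (u + u') *t v = u *t v + u' *t v.
  rewrite tens.unlock -raddfD; apply/tensor_piP.
  by rewrite opprD addrA; exact: TNullDl.
have tDr (u : U) (v v' : V) : u *t (v + v') = u *t v + u *t v'.
  rewrite tens.unlock -raddfD; apply/tensor_piP.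
  by rewrite opprD addrA; exact: TNullDr.
have tZl a (u : U) (v : V) : (a *: u) *t v = a *: (u *t v).
  by rewrite tens.unlock -linearZ; apply/tensor_piP; exact: TNullZl.
have tZr a (u : U) (v : V) : u *t (a *: v) = a *: (u *t v).
  by rewrite tens.unlock -linearZ; apply/tensor_piP; exact: TNullZr.
by split=> u a x y; rewrite ?tDl ?tDr ?tZl ?tZr.
Qed.

HB.instance Definition _ (K : fieldType) (U V : lmodType K) :=
  bilinear_isBilinear.Build K U V (U ⊗ V) _ _ (@tens K U V)
    (@tens_is_bilinear K U V).

HB.instance Definition _ (K : fieldType) (U V : lmodType K) (u : U) :=
  GRing.isLinear.Build K V (U ⊗ V) *:%R (@tens K U V u)
    ((tens_is_bilinear U V).2 u).

Section FreeLift.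
Context {K : fieldType} {T : choiceType} {W : lmodType K} (f : T -> W).

HB.instance Definition _ := GRing.isZmodMorphism.Build {freeg T / K} W
  (fglift f) (@lift_is_additive K T W f).

Lemma fglift_is_scalable : scalable (fglift f : {freeg T / K} -> W).
Proof.
move=> a x; rewrite -[x]freeg_sumE [in LHS]scaler_sumr 2!raddf_sum /=.
rewrite scaler_sumr.
apply: eq_bigr => t _; rewrite liftU scalerA -(liftU f); congr (fglift f _).
by apply/eqP/freeg_eqP => t'; rewrite coeffZ !coeffU mulrA.
Qed.

HB.instance Definition _ := GRing.isScalable.Build K {freeg T / K} W *:%R
  (fglift f) fglift_is_scalable.

End FreeLift.

HB.lock Definition tlift {K : fieldType} {U V W : lmodType K}
  (f : {bilinear U -> V -> W}) (x : U ⊗ V) : W :=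
  fglift (fun uv => f uv.1 uv.2) (tensor_repr x).

Section TensorTheory.
Context {K : fieldType} {U V W : lmodType K}.

Section Lift.
Variable f : {bilinear U -> V -> W}.

Lemma tlift_pi (x : {freeg (U * V)%type / K}) :
  tlift f (tensor_pi x) = fglift (fun uv => f uv.1 uv.2) x.
Proof.
rewrite tlift.unlock; apply/eqP; rewrite -subr_eq0 -raddfB; apply/eqP.
have /tensor_piP : tensor_pi (tensor_repr (tensor_pi x)) = tensor_pi x.
  exact: tensor_reprK.
elim=> [u u' v|u v v'|a u v|a u v||a y z _ y0 _ z0].
- by rewrite !raddfB /= !liftU !scale1r /= linearDl addrAC addrK subrr.
- by rewrite !raddfB /= !liftU !scale1r /= linearDr addrAC addrK subrr.
- by rewrite raddfB /= linearZ /= !liftU !scale1r /= linearZl_LR subrr.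
- by rewrite raddfB /= linearZ /= !liftU !scale1r /= linearZr_LR subrr.
- exact: raddf0.
- by rewrite raddfD /= linearZ /= y0 z0 scaler0 addr0.
Qed.

Lemma tlift_is_linear : linear (tlift f).
Proof.
move=> a x y; rewrite -[x]tensor_reprK -[y]tensor_reprK -linearP.
by rewrite !tlift_pi linearP.
Qed.

HB.instance Definition _ :=
  GRing.isLinear.Build K (U ⊗ V) W *:%R (tlift f) tlift_is_linear.

Lemma tliftE u v : tlift f (u *t v) = f u v.
Proof. by rewrite tens.unlock tlift_pi liftU scale1r. Qed.

End Lift.

Lemma tensor_ext (g h : {linear U ⊗ V -> W}) :
  (forall u v, g (u *t v) = h (u *t v)) -> g =1 h.
Proof.
move=> gh x; rewrite -[x]tensor_reprK -[tensor_repr x]freeg_sumE !raddf_sum /=.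
apply: eq_bigr => -[u v] _ /=; set c := coeff _ _.
have -> : tensor_pi << c *g (u, v) >> = c *: (u *t v) :> U ⊗ V.
  rewrite tens.unlock -linearZ; congr (tensor_pi _).
  by apply/eqP/freeg_eqP => t; rewrite coeffZ !coeffU mul1r.
by rewrite !linearZ /= gh.
Qed.

End TensorTheory.

Section TensorMap.
Context {K : fieldType} {U V U' V' : lmodType K}.
Variables (f : {linear U -> U'}) (g : {linear V -> V'}).

Definition tmap_fun (u : U) (v : V) : U' ⊗ V' := f u *t g v.

Lemma tmap_fun_is_bilinear : bilinear_for *:%R *:%R tmap_fun.
Proof. by split=> u a x y; rewrite /tmap_fun linearP ?linearPl ?linearPr. Qed.

HB.instance Definition _ :=
  bilinear_isBilinear.Build K U V (U' ⊗ V') _ _ tmap_fun tmap_fun_is_bilinear.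

Definition tmap : U ⊗ V -> U' ⊗ V' := tlift tmap_fun.

HB.instance Definition _ := GRing.Linear.on tmap.

Lemma tmapE u v : tmap (u *t v) = f u *t g v.
Proof. exact: tliftE. Qed.

End TensorMap.

Section TensorAssoc.
Context {K : fieldType} {U V W : lmodType K}.

Definition tassoc_pure (w : W) (u : U) (v : V) : U ⊗ (V ⊗ W) := u *t (v *t w).

Lemma tassoc_pure_is_bilinear w : bilinear_for *:%R *:%R (tassoc_pure w).
Proof. by split=> u a x y; rewrite /tassoc_pure ?linearPl ?linearPr. Qed.

HB.instance Definition _ w := bilinear_isBilinear.Build K
  U V (U ⊗ (V ⊗ W)) _ _
  (tassoc_pure w) (tassoc_pure_is_bilinear w).

Definition tassoc_fun (x : U ⊗ V) (w : W) : U ⊗ (V ⊗ W) :=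
  tlift (tassoc_pure w) x.

Lemma tassoc_fun_is_bilinear : bilinear_for *:%R *:%R tassoc_fun.
Proof.
split=> [w|x] a y z; first exact: linearP.
pose g : {linear U ⊗ V -> U ⊗ (V ⊗ W)} :=
  a \*: tlift (tassoc_pure y) \+ tlift (tassoc_pure z).
apply: (tensor_ext (g := tlift _) (h := g)) => u v.
by rewrite /= !tliftE /= /tassoc_pure !linearPr.
Qed.

HB.instance Definition _ := bilinear_isBilinear.Build K
  (U ⊗ V) W (U ⊗ (V ⊗ W)) _ _
  tassoc_fun tassoc_fun_is_bilinear.

Definition tassoc : (U ⊗ V) ⊗ W -> U ⊗ (V ⊗ W) := tlift tassoc_fun.

HB.instance Definition _ := GRing.Linear.on tassoc.

Lemma tassocE u v w : tassoc ((u *t v) *t w) = u *t (v *t w).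
Proof. by rewrite /tassoc tliftE /= /tassoc_fun tliftE. Qed.

Definition tassocV_pure (u : U) (v : V) (w : W) : (U ⊗ V) ⊗ W := (u *t v) *t w.

Lemma tassocV_pure_is_bilinear u : bilinear_for *:%R *:%R (tassocV_pure u).
Proof. by split=> v a x y; rewrite /tassocV_pure ?linearPr ?linearPl. Qed.

HB.instance Definition _ u := bilinear_isBilinear.Build K
  V W ((U ⊗ V) ⊗ W) _ _
  (tassocV_pure u) (tassocV_pure_is_bilinear u).

Definition tassocV_fun (u : U) (x : V ⊗ W) : (U ⊗ V) ⊗ W :=
  tlift (tassocV_pure u) x.

Lemma tassocV_fun_is_bilinear : bilinear_for *:%R *:%R tassocV_fun.
Proof.
split=> [x|u] a y z; last exact: linearP.
pose g : {linear V ⊗ W -> (U ⊗ V) ⊗ W} :=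
  a \*: tlift (tassocV_pure y) \+ tlift (tassocV_pure z).
apply: (tensor_ext (g := tlift _) (h := g)) => v w.
by rewrite /= !tliftE /= /tassocV_pure !linearPl.
Qed.

HB.instance Definition _ := bilinear_isBilinear.Build K
  U (V ⊗ W) ((U ⊗ V) ⊗ W) _ _
  tassocV_fun tassocV_fun_is_bilinear.

Definition tassocV : U ⊗ (V ⊗ W) -> (U ⊗ V) ⊗ W := tlift tassocV_fun.

HB.instance Definition _ := GRing.Linear.on tassocV.

Lemma tassocVE u v w : tassocV (u *t (v *t w)) = (u *t v) *t w.
Proof. by rewrite /tassocV tliftE /= /tassocV_fun tliftE. Qed.

Lemma tassocK : cancel tassoc tassocV.
Proof.
apply: (tensor_ext (g := tassocV \o tassoc) (h := idfun)) => x w.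
apply: (tensor_ext (g := tassocV \o tassoc \o applyr tens w)
                   (h := applyr tens w)) => u v.
by rewrite /= tassocE tassocVE.
Qed.

Lemma tassocVK : cancel tassocV tassoc.
Proof.
apply: (tensor_ext (g := tassoc \o tassocV) (h := idfun)) => u x.
apply: (tensor_ext (g := tassoc \o tassocV \o tens u)
                   (h := tens u)) => v w.
by rewrite /= tassocVE tassocE.
Qed.

End TensorAssoc.

Section TensorInterchange.
Context {K : fieldType} {U V U' V' : lmodType K}.

Local Notation T := ((U ⊗ U') ⊗ (V ⊗ V')).

Definition tinter_pure (u : U) (v : V) (u' : U') (v' : V') : T :=
  (u *t u') *t (v *t v').

Lemma tinter_pure_is_bilinear u v : bilinear_for *:%R *:%R (tinter_pure u v).
Proof. by split=> w a x y; rewrite /tinter_pure ?linearPr ?linearPl. Qed.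

HB.instance Definition _ u v := bilinear_isBilinear.Build K
  U' V' T _ _
  (tinter_pure u v) (tinter_pure_is_bilinear u v).

Definition tinter_left (y : U' ⊗ V') (u : U) (v : V) : T :=
  tlift (tinter_pure u v) y.

Lemma tinter_left_is_bilinear y : bilinear_for *:%R *:%R (tinter_left y).
Proof.
split=> [v|u] a w z.
  apply: (tensor_ext (g := tlift _)
    (h := a \*: tlift (tinter_pure w v) \+ tlift (tinter_pure z v))) => u' v'.
  by rewrite /= !tliftE /= /tinter_pure !linearPl.
apply: (tensor_ext (g := tlift _)
  (h := a \*: tlift (tinter_pure u w) \+ tlift (tinter_pure u z))) => u' v'.
by rewrite /= !tliftE /= /tinter_pure linearPl linearPr.
Qed.

HB.instance Definition _ y := bilinear_isBilinear.Build K
  U V T _ _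
  (tinter_left y) (tinter_left_is_bilinear y).

Definition tinter_fun (x : U ⊗ V) (y : U' ⊗ V') : T := tlift (tinter_left y) x.

Lemma tinter_fun_is_bilinear : bilinear_for *:%R *:%R tinter_fun.
Proof.
split=> [y|x] a w z; first exact: linearP.
apply: (tensor_ext (g := tlift _)
  (h := a \*: tlift (tinter_left w) \+ tlift (tinter_left z))) => u v.
by rewrite /= !tliftE /= /tinter_left linearP.
Qed.

HB.instance Definition _ := bilinear_isBilinear.Build K
  (U ⊗ V) (U' ⊗ V') T _ _
  tinter_fun tinter_fun_is_bilinear.

Definition tinter : (U ⊗ V) ⊗ (U' ⊗ V') -> T := tlift tinter_fun.

HB.instance Definition _ := GRing.Linear.on tinter.

Lemma tinterE u v u' v' :
  tinter ((u *t v) *t (u' *t v')) = (u *t u') *t (v *t v').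
Proof.
by rewrite /tinter tliftE /= /tinter_fun tliftE /= /tinter_left tliftE.
Qed.

End TensorInterchange.

Section GDQ.
Context {K : fieldType} {A : lmodType K}.
Implicit Types (mu : {linear A ⊗ A -> A}) (d : {linear A -> A ⊗ A}).

(* A (not necessarily unital) algebra is a space A with an associative        *)
(* multiplication map mu : A ⊗ A -> A.                                        *)
Definition mul_assoc mu :=
  forall x : (A ⊗ A) ⊗ A, mu (tmap mu idfun x) = mu (tmap idfun mu (tassoc x)).

(* (d1 ⊗ id) d2 = (id ⊗ d2) d1; here and below the associators make the       *)
(* identification (A ⊗ A) ⊗ A = A ⊗ (A ⊗ A) explicit.                         *)
Definition compatible d1 d2 :=
  forall a, tassoc (tmap d1 idfun (d2 a)) = tmap idfun d2 (d1 a).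

Definition coassociative d := compatible d d.

Definition derivation mu d :=
  forall x : A ⊗ A, d (mu x) = tmap idfun mu (tassoc (tmap d idfun x))
                             + tmap mu idfun (tassocV (tmap idfun d x)).

Definition GDQ_ring mu d :=
  [/\ mul_assoc mu, coassociative d & derivation mu d].

(* The first clause only matters when S is empty. *)
Definition multi_GDQ_ring (S : finType) mu (d : S -> {linear A -> A ⊗ A}) :=
  [/\ mul_assoc mu, forall s, GDQ_ring mu (d s)
    & forall s t, compatible (d s) (d t)].

End GDQ.

Definition tmul {K : fieldType} {A B : lmodType K}
    (muA : {linear A ⊗ A -> A}) (muB : {linear B ⊗ B -> B}) :
  (A ⊗ B) ⊗ (A ⊗ B) -> A ⊗ B := tmap muA muB \o tinter.

HB.instance Definition _ (K : fieldType) (A B : lmodType K)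
    (muA : {linear A ⊗ A -> A}) (muB : {linear B ⊗ B -> B}) :=
  GRing.Linear.on (tmul muA muB).

Lemma tmulE (K : fieldType) (A B : lmodType K)
    (muA : {linear A ⊗ A -> A}) (muB : {linear B ⊗ B -> B}) a b a' b' :
  tmul muA muB ((a *t b) *t (a' *t b')) = muA (a *t a') *t muB (b *t b').
Proof. by rewrite /tmul /= tinterE tmapE. Qed.

Definition mx_mul {K : fieldType} {p : nat} :
 'M[K]_p ⊗ 'M[K]_p -> 'M[K]_p := tlift (@mulmx K p p p).

HB.instance Definition _ (K : fieldType) (p : nat) :=
  GRing.Linear.on (@mx_mul K p).

Lemma mx_mulE (K : fieldType) (p : nat) (S T : 'M[K]_p) :
  mx_mul (S *t T) = S *m T.
Proof. by rewrite /mx_mul tliftE. Qed.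

(* The matrix algebra M_p(A) is represented by 'M_p ⊗ A. *)
Section Amplification.
Context {K : fieldType} {p : nat} {A : lmodType K}.
Variable d : 'I_p -> 'I_p -> {linear A -> A ⊗ A}.

Local Notation Mp := 'M[K]_p.

Definition amp_Delta (i j : 'I_p) : Mp ⊗ Mp :=
  \sum_(k < p) delta_mx k i *t delta_mx j k.

Definition amp_fun (T : Mp) (a : A) : (Mp ⊗ A) ⊗ (Mp ⊗ A) :=
  \sum_(i < p) \sum_(j < p)
    tinter (tmul mx_mul mx_mul ((T *t 1%:M) *t amp_Delta i j)
            *t d i j a).

Lemma amp_fun_is_bilinear : bilinear_for *:%R *:%R amp_fun.
Proof.
split=> u a x y; rewrite /= /amp_fun scaler_sumr -big_split;
  apply: eq_bigr => i _; rewrite /= scaler_sumr -big_split;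
  apply: eq_bigr => j _ /=.
- by rewrite 2!linearPl linearP linearPl linearP.
- by rewrite linearP linearPr linearP.
Qed.

HB.instance Definition _ := bilinear_isBilinear.Build K
  Mp A ((Mp ⊗ A) ⊗ (Mp ⊗ A)) _ _
  amp_fun amp_fun_is_bilinear.

Definition amp_diff : Mp ⊗ A -> (Mp ⊗ A) ⊗ (Mp ⊗ A) := tlift amp_fun.

HB.instance Definition _ := GRing.Linear.on amp_diff.

Lemma amp_diffE T a : amp_diff (T *t a) = amp_fun T a.
Proof. by rewrite /amp_diff tliftE. Qed.

End Amplification.

(* Main.v *)
From HB Require Import structures.
Require Import Defs.
From mathcomp Require Import all_boot all_order all_algebra.
From mathcomp Require Import reals complex.
From mathcomp Require Import freeg.

(** With [e k i] the matrix units, the amplified derivation sends [T ⊗ a] to the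
    sum over [i], [j], [k] of [(T e_ki ⊗ e_jk) ⊗ d_ij a].  Both iterates of it
    collapse, by the multiplication rule of matrix units, to a sum of terms
    [T e_ki ⊗ e_ji' ⊗ e_j'k] paired with one side of the compatibility relation
    of [d_ij] and [d_i'j'], so coassociativity is compatibility up to renaming
    the indices.  The Leibniz rule follows from that of each [d_ij], since the
    Casimir-like sum over [k] of [e_ki ⊗ e_jk] satisfies
    [sum_k e_ki ⊗ e_jk T = sum_k T e_ki ⊗ e_jk]. *)

Set Implicit Arguments.
Unset Strict Implicit.
Unset Printing Implicit Defensive.

Import GRing.Theory.

Local Open Scope ring_scope.

(** Every tensor is a finite sum of pure ones: a coefficient is absorbed into the left factor, and
    the empty sum is the pure tensor [0 *t 0]. *)
Lemma tensor_ind (K : fieldType) (U V : lmodType K) (P : U ⊗ V -> Prop) :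
  (forall u v, P (u *t v)) -> (forall x y, P x -> P y -> P (x + y)) ->
  forall x, P x.
Proof.
move=> Ppure PD x; rewrite -[x]tensor_reprK -[tensor_repr x]freeg_sumE raddf_sum /=.
apply: (big_ind P) => [|//|[u v] _].
  have <- : 0 *t 0 = 0 :> U ⊗ V by rewrite linear0.
  exact: Ppure.
set c := coeff _ _.
suff -> : tensor_pi << c *g (u, v) >> = (c *: u) *t v :> U ⊗ V by [].
rewrite linearZl_LR /= tens.unlock -linearZ; congr (tensor_pi _).
by apply/eqP/freeg_eqP => t; rewrite coeffZ !coeffU mul1r.
Qed.

Lemma tensor_ext3 (K : fieldType) (U V W Y : lmodType K)
    (g h : {linear (U ⊗ V) ⊗ W -> Y}) :
  (forall u v w, g ((u *t v) *t w) = h ((u *t v) *t w)) -> g =1 h.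
Proof.
move=> gh; apply: tensor_ext => x w; elim/tensor_ind: x => // x y gx gy.
by rewrite linearDl /= !linearD gx gy.
Qed.

Lemma tensor_ext4 (K : fieldType) (U V W X Y : lmodType K)
    (g h : {linear (U ⊗ V) ⊗ (W ⊗ X) -> Y}) :
  (forall u v w x, g ((u *t v) *t (w *t x)) = h ((u *t v) *t (w *t x))) ->
  g =1 h.
Proof.
move=> gh; apply: tensor_ext3 => u v z; elim/tensor_ind: z => // x y gx gy.
by rewrite !linearD /= gx gy.
Qed.

Section TensorMul.
Context {K : fieldType}.

Lemma mx_mul_assoc p : mul_assoc (@mx_mul K p).
Proof.
apply: (tensor_ext3 (g := mx_mul \o tmap mx_mul idfun)
                    (h := mx_mul \o tmap idfun mx_mul \o tassoc)) => S T U /=.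
by rewrite tassocE !tmapE /= !mx_mulE mulmxA.
Qed.

Lemma tmul_assoc (A B : lmodType K)
    (muA : {linear A ⊗ A -> A}) (muB : {linear B ⊗ B -> B}) :
  mul_assoc muA -> mul_assoc muB -> mul_assoc (tmul muA muB).
Proof.
move=> assocA assocB.
apply: (tensor_ext3
  (g := tmul muA muB \o tmap (tmul muA muB) idfun)
  (h := tmul muA muB \o tmap idfun (tmul muA muB) \o tassoc)) => x y z /=.
rewrite tassocE !tmapE /=.
(* Each of the three factors is still an arbitrary element of [A ⊗ B]; on pure tensors the claim
   splits into [assocA] and [assocB]. *)
elim/tensor_ind: x => [a b|x x' Hx Hx']; last first.
  by rewrite !(linearDl, linearD) /= Hx Hx'.
elim/tensor_ind: y => [a' b'|y y' Hy Hy']; last first.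
  by rewrite !(linearDl, linearD) /= Hy Hy'.
elim/tensor_ind: z => [a'' b''|z z' Hz Hz']; last first.
  by rewrite !(linearDl, linearD) /= Hz Hz'.
have := assocA ((a *t a') *t a''); have := assocB ((b *t b') *t b'').
by rewrite !tmulE !tassocE !tmapE /= => -> ->.
Qed.

End TensorMul.

Section Amplification.
Context {K : fieldType} {p : nat} {A : lmodType K}.
Variables (mu : {linear A ⊗ A -> A}) (d : 'I_p -> 'I_p -> {linear A -> A ⊗ A}).

Local Notation Mp := 'M[K]_p.
Local Notation e i j := (delta_mx i j : Mp).

Lemma amp_diff_tens (T : Mp) a : amp_diff d (T *t a) =
  \sum_i \sum_j \sum_k tinter (((T *m e k i) *t e j k) *t d i j a).
Proof.
rewrite amp_diffE /amp_fun; apply: eq_bigr => i _; apply: eq_bigr => j _.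
rewrite /amp_Delta !linear_sum linear_sumlz linear_sum /=.
by apply: eq_bigr => k _; rewrite tmulE /= !mx_mulE mul1mx.
Qed.

(* [amp3l] and [amp3r] regroup the two bracketings of M_p^{⊗3} ⊗ A^{⊗3} into
   M_p(A)^{⊗3}. *)
Definition amp3l : ((Mp ⊗ Mp) ⊗ Mp) ⊗ ((A ⊗ A) ⊗ A) ->
    ((Mp ⊗ A) ⊗ (Mp ⊗ A)) ⊗ (Mp ⊗ A) :=
  tmap tinter idfun \o tinter.

HB.instance Definition _ := GRing.Linear.on amp3l.

Definition amp3r : (Mp ⊗ (Mp ⊗ Mp)) ⊗ (A ⊗ (A ⊗ A)) ->
    (Mp ⊗ A) ⊗ ((Mp ⊗ A) ⊗ (Mp ⊗ A)) :=
  tmap idfun tinter \o tinter.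

HB.instance Definition _ := GRing.Linear.on amp3r.

(** Regrouping commutes with reassociating matrices and [A]-factors separately. The associator thus
    reaches [y], where compatibility can be applied. *)
Lemma tassoc_amp3l S T U y :
  tassoc (amp3l (((S *t T) *t U) *t y)) = amp3r ((S *t (T *t U)) *t tassoc y).
Proof.
pose f := tassoc \o tmap tinter idfun \o tinter \o tens ((S *t T) *t U)
  : (A ⊗ A) ⊗ A -> _.
pose g := tmap idfun tinter \o tinter \o tens (S *t (T *t U)) \o tassoc
  : (A ⊗ A) ⊗ A -> (Mp ⊗ A) ⊗ ((Mp ⊗ A) ⊗ (Mp ⊗ A)).
apply: (tensor_ext3 (g := f) (h := g)) => a b c; rewrite /f /g /=.
by rewrite tassocE !tinterE !tmapE /= !tinterE tassocE.
Qed.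

(** The tensor [y] is kept arbitrary because it will be some [d i j a], which need not be pure. *)
Lemma amp_diff_idl S T y :
  tmap (amp_diff d) idfun (tinter ((S *t T) *t y)) =
  \sum_i \sum_j \sum_k
    amp3l ((((S *m e k i) *t e j k) *t T) *t tmap (d i j) idfun y).
Proof.
elim/tensor_ind: y => [a b|y z Hy Hz]; last first.
  rewrite !linearD /= Hy Hz -big_split; apply: eq_bigr => i _ /=.
  rewrite -big_split; apply: eq_bigr => j _ /=.
  by rewrite -big_split; apply: eq_bigr => k _ /=; rewrite !linearD.
rewrite tinterE tmapE /= amp_diff_tens linear_sumlz; apply: eq_bigr => i _.
rewrite linear_sumlz; apply: eq_bigr => j _.
rewrite linear_sumlz; apply: eq_bigr => k _.
by rewrite tmapE /= /amp3l /= tinterE tmapE.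
Qed.

Lemma amp_diff_idr S T y :
  tmap idfun (amp_diff d) (tinter ((S *t T) *t y)) =
  \sum_i \sum_j \sum_k
    amp3r ((S *t ((T *m e k i) *t e j k)) *t tmap idfun (d i j) y).
Proof.
elim/tensor_ind: y => [a b|y z Hy Hz]; last first.
  rewrite !linearD /= Hy Hz -big_split; apply: eq_bigr => i _ /=.
  rewrite -big_split; apply: eq_bigr => j _ /=.
  by rewrite -big_split; apply: eq_bigr => k _ /=; rewrite !linearD.
rewrite tinterE tmapE /= amp_diff_tens linear_sum; apply: eq_bigr => i _.
rewrite linear_sum; apply: eq_bigr => j _.
rewrite linear_sum; apply: eq_bigr => k _.
by rewrite tmapE /= /amp3r /= tinterE tmapE.
Qed.

Lemma amp_diff_coassoc :
  (forall i j i' j', compatible (d i j) (d i' j')) ->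
  coassociative (amp_diff d).
Proof.
move=> comp_d; apply: (tensor_ext
  (g := tassoc \o tmap (amp_diff d) idfun \o amp_diff d)
  (h := tmap idfun (amp_diff d) \o amp_diff d)) => T a /=.
rewrite amp_diff_tens.
pose F i j i' j' k :=
  amp3r (((T *m e k i) *t (e j i' *t e j' k)) *t tmap idfun (d i' j') (d i j a)).
(* The pairs are swapped in [F] because compatibility turns [d i j] followed by [d i' j'] on the
   left factor into [d i' j'] followed by [d i j] on the right factor. *)
transitivity (\sum_i \sum_j \sum_i' \sum_j' \sum_k F i' j' i j k).
  rewrite !linear_sum; apply: eq_bigr => i _.
  rewrite !linear_sum; apply: eq_bigr => j _ /=.
  rewrite !linear_sum /=.
  under eq_bigr do rewrite amp_diff_idl linear_sum /=.
  rewrite exchange_big; apply: eq_bigr => i' _ /=.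
  under eq_bigr do rewrite linear_sum /=.
  rewrite exchange_big; apply: eq_bigr => j' _ /=.
  apply: eq_bigr => k _ /=; rewrite linear_sum /=.
  (* The first matrix factor contains [e k i *m e k' i'], so only [k' = i] survives. *)
  rewrite (bigD1 i) //= big1 ?addr0 => [|k']; last first.
    rewrite eq_sym => ik'; rewrite -mulmxA mul_delta_mx_0 //.
    by rewrite mulmx0 !(linear0l, linear0).
  by rewrite -mulmxA mul_delta_mx tassoc_amp3l comp_d.
transitivity (\sum_i \sum_j \sum_i' \sum_j' \sum_k F i j i' j' k).
  under eq_bigr do rewrite exchange_big /=.
  rewrite exchange_big; apply: eq_bigr => i _ /=.
  under eq_bigr do rewrite exchange_big /=.
  by rewrite exchange_big.
rewrite !linear_sum; apply: eq_bigr => i _.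
rewrite !linear_sum; apply: eq_bigr => j _ /=.
rewrite !linear_sum /=.
under [RHS]eq_bigr do rewrite amp_diff_idr.
rewrite [RHS]exchange_big; apply: eq_bigr => i' _ /=.
rewrite [RHS]exchange_big; apply: eq_bigr => j' _ /=.
apply: eq_bigr => k _ /=.
(* Here the product is [e j k *m e k' i'], in the middle factor, so only [k' = k] survives. *)
rewrite (bigD1 k) //= big1 ?addr0 => [|k']; last first.
  by rewrite eq_sym => kk'; rewrite mul_delta_mx_0 // !(linear0l, linear0).
by rewrite mul_delta_mx.
Qed.

(** Expand [T] in matrix units: for the unit [e u v], the left sum keeps only [k = u] and the right
    sum only [k = v], and both leave [(S *m e u i) *t e j v]. *)
Lemma tens_delta_mulmx (S T : Mp) i j :
  \sum_k (S *m e k i) *t (e j k *m T) = \sum_k (S *m T *m e k i) *t e j k.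
Proof.
rewrite [T]matrix_sum_delta.
under eq_bigr do rewrite mulmx_sumr linear_sum /=.
under [RHS]eq_bigr do rewrite mulmx_sumr mulmx_suml linear_sumlz /=.
rewrite exchange_big [RHS]exchange_big; apply: eq_bigr => u _ /=.
under eq_bigr do rewrite mulmx_sumr linear_sum /=.
under [RHS]eq_bigr do rewrite mulmx_sumr mulmx_suml linear_sumlz /=.
rewrite exchange_big [RHS]exchange_big; apply: eq_bigr => v _ /=.
rewrite (bigD1 u) // [RHS](bigD1 v) //= !big1 ?addr0 => [|k|k ku].
- rewrite -!scalemxAr -scalemxAl -mulmxA !mul_delta_mx.
  by rewrite linearZ linearZl_LR.
- rewrite eq_sym => vk; rewrite -scalemxAr -scalemxAl -mulmxA.
  by rewrite mul_delta_mx_0 // mulmx0 scaler0 linear0l.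
- by rewrite -scalemxAr mul_delta_mx_0 // scaler0 linear0.
Qed.

(** Right multiplication touches only the second leg, in the matrices and in [A] alike. *)
Lemma tmul_tinterr (P Q T : Mp) (y : A ⊗ A) b :
  tmap idfun (tmul mx_mul mu) (tassoc (tinter ((P *t Q) *t y) *t (T *t b))) =
  tinter ((P *t (Q *m T)) *t tmap idfun mu (tassoc (y *t b))).
Proof.
elim/tensor_ind: y => [a a'|y z Hy Hz]; last first.
  by rewrite !(linearDl, linearD) /= Hy Hz.
by rewrite tinterE !tassocE !tmapE /= tinterE tmulE /= mx_mulE.
Qed.

Lemma tmul_tinterl (S P Q : Mp) a (y : A ⊗ A) :
  tmap (tmul mx_mul mu) idfun (tassocV ((S *t a) *t tinter ((P *t Q) *t y))) =
  tinter (((S *m P) *t Q) *t tmap mu idfun (tassocV (a *t y))).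
Proof.
elim/tensor_ind: y => [b b'|y z Hy Hz]; last first.
  by rewrite !(linearDl, linearD) /= Hy Hz.
by rewrite tinterE !tassocVE !tmapE /= tinterE tmulE /= mx_mulE.
Qed.

Lemma amp_diff_derivation :
  (forall i j, derivation mu (d i j)) ->
  derivation (tmul mx_mul mu) (amp_diff d).
Proof.
move=> der_d; apply: (tensor_ext4
  (g := amp_diff d \o tmul mx_mul mu)
  (h := (tmap idfun (tmul mx_mul mu) \o tassoc \o tmap (amp_diff d) idfun)
        \+ (tmap (tmul mx_mul mu) idfun \o tassocV \o tmap idfun (amp_diff d))))
  => S a T b /=.
rewrite tmulE /= mx_mulE !tmapE /= !amp_diff_tens.
rewrite linear_sumlz !linear_sum -big_split; apply: eq_bigr => i _ /=.
rewrite linear_sumlz !linear_sum -big_split; apply: eq_bigr => j _ /=.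
rewrite linear_sumlz !linear_sum.
under [X in X + _]eq_bigr do rewrite /= tmul_tinterr.
under [X in _ + X]eq_bigr do rewrite /= tmul_tinterl mulmxA.
(* With the sums over [k] gathered in the matrix part, moving [T] across gives both Leibniz terms
   the same matrix part. They then add up in [A ⊗ A], where the Leibniz rule of [d i j] applies. *)
rewrite -!linear_sum -!linear_sumlz /= tens_delta_mulmx -!linearD /=.
by rewrite der_d !tmapE.
Qed.

End Amplification.

Theorem mainTheorem2 (R : realType) (p : nat) (hp : (1 <= p)%N)
    (A : lmodType R[i]) (mu : {linear A ⊗ A -> A})
    (d : 'I_p -> 'I_p -> {linear A -> A ⊗ A})
    (hA : multi_GDQ_ring mu (fun s : 'I_p * 'I_p => d s.1 s.2)) :
  GDQ_ring (A := 'M[R[i]]_p ⊗ A) (tmul mx_mul mu) (amp_diff d).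
Proof.
case: hA => mu_assoc gdq_d comp_d; split.
- exact: tmul_assoc (@mx_mul_assoc _ p) mu_assoc.
- by apply: amp_diff_coassoc => i j i' j'; apply: (comp_d (i, j) (i', j')).
- by apply: amp_diff_derivation => i j; case: (gdq_d (i, j)).
Qed.
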